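(* For every prime $m\neq 2$, the Cartesian product graph $\Gamma(\mathbb{Z}_6)\times\Gamma(\mathbb{Z}_{2m})$ admits a distance antimagic labeling.
   Context: For an integer $n \geq 2$, the zero-divisor graph $\Gamma(\mathbb{Z}_n)$ is the simple graph whose vertex set is the set of nonzero zero-divisors of the ring $\mathbb{Z}_n$, two distinct vertices $u,v$ being adjacent iff $uv \equiv 0 \pmod n$. The Cartesian product $G\times H$ has vertex set $V(G)\times V(H)$, with $(u,v)$ adjacent to $(u',v')$ iff either $u=u'$ and $vv'\in E(H)$, or $v=v'$ and $uu'\in E(G)$. A distance antimagic labeling (DAML) of a graph $G$ with $N$ vertices is a bijection $f:V(G)\to\{1,\dots,N\}$ such that the weights $w(v)=\sum_{u\in N(v)} f(u)$, where $N(v)$ is the open neighbourhood of $v$, are pairwise distinct over all vertices $v$. A graph admits DAML if such a labeling exists. *)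

(* Defs.v *)
From HB Require Import structures.
From mathcomp Require Import all_boot all_order all_algebra.

Set Implicit Arguments.
Unset Strict Implicit.
Unset Printing Implicit Defensive.

Record sgraph := SGraph {
  vertex :> finType;
  edge : rel vertex;
  edge_sym : symmetric edge;
  edge_irrefl : irreflexive edge
}.

Section Cartesian.
Variables G H : sgraph.

Definition cart_edge : rel (G * H) := fun p q =>
  ((p.1 == q.1) && edge p.2 q.2) || ((p.2 == q.2) && edge p.1 q.1).

Lemma cart_edge_sym : symmetric cart_edge.
Proof.
by move=> p q; rewrite /cart_edge !(eq_sym q.1, eq_sym q.2) !(@edge_sym _ q.1, @edge_sym _ q.2).
Qed.

Lemma cart_edge_irrefl : irreflexive cart_edge.
Proof. by move=> p; rewrite /cart_edge !edge_irrefl !andbF. Qed.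

Definition cart_prod : sgraph := SGraph cart_edge_sym cart_edge_irrefl.

End Cartesian.

(* 'Z_n is the ring of integers mod n only when 2 <= n. *)
Section ZeroDivisorGraph.
Variable n : nat.
Local Open Scope ring_scope.

Definition zero_divisor (x : 'Z_n) : bool :=
  [exists y : 'Z_n, (y != 0) && (x * y == 0)].

Definition zdg_vertex : finType := {x : 'Z_n | (x != 0) && zero_divisor x}.

Definition zdg_edge : rel zdg_vertex := fun u v =>
  (u != v) && (val u * val v == 0).

Lemma zdg_edge_sym : symmetric zdg_edge.
Proof. by move=> u v; rewrite /zdg_edge eq_sym GRing.mulrC. Qed.

Lemma zdg_edge_irrefl : irreflexive zdg_edge.
Proof. by move=> u; rewrite /zdg_edge eqxx. Qed.

Definition zero_divisor_graph : sgraph := SGraph zdg_edge_sym zdg_edge_irrefl.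

End ZeroDivisorGraph.

Definition weight (G : sgraph) (f : G -> nat) (v : G) : nat :=
  \sum_(u | edge v u) f u.

Definition is_DAML (G : sgraph) (f : G -> nat) : Prop :=
  [/\ injective f,
      forall k : nat, (exists v, f v = k) <-> 1 <= k <= #|G|
    & injective (weight f)].

Definition admits_DAML (G : sgraph) : Prop := exists f : G -> nat, is_DAML f.

(* Main.v *)
Require Import Defs.
From HB Require Import structures.
From mathcomp Require Import all_boot all_order all_algebra.
From mathcomp Require Import zify.

(** For an odd prime [p], the graph of ['Z_(2 * p)] is a star: the centre [p] is
    joined to the leaves [2j], [0 < j < p].  So the product is a path [2 - 3 - 4]
    times a star with [m - 1] leaves.  Label the copies of the [j]th leaf in the
    rows 3, 2, 4 by [j], [m - 1 + 2j], [m + 2j], and the copies of the centre by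
    [3m], [m], [3m - 1].  The weights of the leaves then lie in three disjoint
    ranges.  The weights of the copies of the centre are quadratic in [m]; they
    avoid the leaf weights by size and, since [m] is odd, by parity, except in
    row 3 when [m < 11], where a collision with the [j]th leaf would mean
    [m * (m - 3) = 8j]. *)

(** * Weights in a product, and residues as coordinates *)

Lemma weight_cart (G H : sgraph) (f : cart_prod G H -> nat) (x : G) (y : H) :
  weight f (x, y) =
  \sum_(x' | edge x x') f (x', y) + \sum_(y' | edge y y') f (x, y').
Proof.
rewrite /weight (bigID (fun q : G * H => q.1 == x)) /= addnC; congr (_ + _).
  rewrite (reindex_onto (fun x' => (x', y)) (fun q => q.1)) /=; last first.
    move=> [x' y'] /=; rewrite /cart_edge /= => /andP[/orP[/andP[/eqP->]|]].
      by rewrite eqxx.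
    by case/andP=> /eqP->.
  apply: eq_bigl => x'; rewrite /cart_edge /= !eqxx andbT edge_irrefl andbF /=.
  by case: eqP => [->|]; rewrite ?edge_irrefl ?andbT.
rewrite (reindex_onto (fun y' => (x, y')) (fun q => q.2)) /=; last first.
  by move=> [x' y'] /= /andP[_ /eqP->].
apply: eq_bigl => y'; rewrite /cart_edge /= !eqxx !andbT edge_irrefl andbF orbF.
by [].
Qed.

Definition residue {n : nat} (v : zero_divisor_graph n) : nat := val (val v).

Lemma residue_inj (n : nat) : injective (@residue n).
Proof. by move=> u v e; do 2!apply: val_inj. Qed.

Lemma Zp_mul_eq0 (n : nat) (x y : 'Z_n) :
  1 < n -> ((x * y)%R == 0%R) = (n %| x * y).
Proof.
by move=> n_gt1; rewrite -val_eqE /= /dvdn; congr (_ %% _ == 0); apply: Zp_cast.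
Qed.

(** * The graph of ['Z_(2 * p)] as a star *)

Section Star.

Variable p : nat.
Hypotheses (p_pr : prime p) (p_odd : odd p).

Let p_gt1 : 1 < 2 * p. Proof. by have := prime_gt1 p_pr; lia. Qed.

(** An odd [x < 2p] other than [p] is coprime to [2p], so it kills only zero; conversely [p] is
    killed by [2], and an even [x] by [p]. *)
Lemma zero_divisor_double_prime (x : 'Z_(2 * p)) :
  (x != 0%R) && zero_divisor x = (0 < x) && ((x == p :> nat) || ~~ odd x).
Proof.
rewrite -val_eqE /= -lt0n; case: posnP => //= x_gt0.
have p_gt2 : 2 < p by have := prime_gt1 p_pr; lia.
have x_lt : x < 2 * p by rewrite -[ltnRHS](Zp_cast p_gt1).
apply/existsP/orP => [[y]|x_spec].
  rewrite Zp_mul_eq0 // -val_eqE /= => /andP[y_neq0 dvd_xy].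
  have [x_odd|x_even] := boolP (odd x); last by right.
  left; apply/negPn/negP => x_neqp.
  have y_lt : y < 2 * p by rewrite -[ltnRHS](Zp_cast p_gt1).
  have co : coprime (2 * p) x.
    rewrite coprimeMl coprime2n x_odd prime_coprime //.
    apply/negP => /dvdnP[c xE]; move: x_neqp x_odd x_lt x_gt0; rewrite xE.
    (* Here [x = c * p]: [c = 0] contradicts [0 < x], [c = 1] contradicts [x <> p], a larger [c]
       contradicts [x < 2p]. *)
    by case: c {xE} => [|[|c]]; rewrite ?mul1n ?eqxx //; nia.
  by move: dvd_xy; rewrite Gauss_dvdr // => /dvdn_leq; lia.
have dvd_witness (c : nat) : 0 < c < 2 * p -> 2 * p %| x * c ->
    exists y : 'Z_(2 * p), (y != 0%R) && ((x * y)%R == 0%R).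
  move=> /andP[c_gt0 c_lt] dvd_xc; exists (c%:R)%R.
  by rewrite Zp_mul_eq0 // -val_eqE /= val_Zp_nat // modn_small // -lt0n c_gt0.
case: x_spec => [/eqP x_eq|x_even].
  by apply: (dvd_witness 2); [lia | rewrite x_eq mulnC].
by apply: (dvd_witness p); [lia | rewrite dvdn_pmul2r ?dvdn2; lia].
Qed.

Lemma residueP (v : zero_divisor_graph (2 * p)) :
  residue v = p \/ exists2 j, 0 < j < p & residue v = 2 * j.
Proof.
case: v => x xP; rewrite /residue /=.
have x_lt : x < 2 * p by rewrite -[ltnRHS](Zp_cast p_gt1).
move: xP; rewrite zero_divisor_double_prime => /andP[x_gt0 /orP[/eqP|x_even]].
  by left.
by right; exists (x./2); lia.
Qed.

Lemma sum_residue (F : nat -> nat) :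
  \sum_(v : zero_divisor_graph (2 * p)) F (residue v) =
  F p + \sum_(1 <= j < p) F (2 * j).
Proof.
have p_gt0 := prime_gt0 p_pr.
have -> : \sum_(v : zero_divisor_graph (2 * p)) F (residue v) =
    \sum_(0 <= i < 2 * p | (0 < i) && ((i == p) || ~~ odd i)) F i.
  transitivity (\sum_(x : 'Z_(2 * p) | (x != 0%R) && zero_divisor x) F x).
    exact/esym/(big_sub (fun x : 'Z_(2 * p) => (x != 0%R) && zero_divisor x)).
  rewrite (eq_bigl _ _ zero_divisor_double_prime).
  by rewrite -[in RHS](Zp_cast p_gt1) big_mkord.
have big_even n : 0 < n ->
    \sum_(0 <= i < 2 * n | (0 < i) && ~~ odd i) F i = \sum_(1 <= j < n) F (2 * j).
  case: n => // n _; elim: n => [|n IHn].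
    by rewrite unlock.
  rewrite [RHS]big_nat_recr // -IHn (_ : 2 * n.+2 = (2 * n.+1).+2); last by lia.
  have : odd (2 * n.+1) = false by lia.
  have : 0 < 2 * n.+1 by [].
  move: (2 * n.+1) => N N_gt0 N_even.
  rewrite big_mkcond big_nat_recr //= big_nat_recr //= -big_mkcond.
  by rewrite N_even N_gt0 addn0.
have p_lt : p < 2 * p by lia.
rewrite big_mkord (bigD1 (Ordinal p_lt)) /= ?p_gt0 ?eqxx //; congr (_ + _).
rewrite -big_even // big_mkord; apply: eq_bigl => i; rewrite -val_eqE /=.
by case: eqP => [->|]; rewrite ?p_odd ?andbF ?andbT.
Qed.

(** The product of [p] and [2j] is a multiple of [2p], whereas [2p] dividing [4ij] would make [p]
    divide [2], [i] or [j], all positive and smaller than [p]. *)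
Lemma edge_residue (u v : zero_divisor_graph (2 * p)) :
  edge u v = (residue u == p) (+) (residue v == p).
Proof.
have p_gt0 := prime_gt0 p_pr.
rewrite /= /zdg_edge -(inj_eq (@residue_inj _)) Zp_mul_eq0 //.
rewrite -[val (val u)]/(residue u) -[val (val v)]/(residue v).
have centre_leaf i : (2 * i == p) = false by apply/eqP; lia.
case: (residueP u) (residueP v) => [->|[i i_lt ->]] [->|[j j_lt ->]];
  rewrite ?eqxx ?centre_leaf // 1?[p == _]eq_sym ?centre_leaf //=.
- by rewrite mulnCA dvdn_pmul2l // dvdn_mulr.
- by rewrite -mulnA dvdn_pmul2l // dvdn_mull.
apply/negbTE/nandP; right; rewrite -mulnA dvdn_pmul2l //.
by rewrite !Euclid_dvdM // !gtnNdvd //; lia.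
Qed.

Lemma sum_edge_residue (F : nat -> nat) (u : zero_divisor_graph (2 * p)) :
  \sum_(v | edge u v) F (residue v) =
  if residue u == p then \sum_(1 <= j < p) F (2 * j) else F p.
Proof.
under eq_bigl do rewrite edge_residue.
have centre_leaf i : (2 * i == p) = false by apply/eqP; lia.
rewrite big_mkcond (sum_residue (fun t => if (residue u == p) (+) (t == p) then F t else 0)).
rewrite eqxx; case: eqP => _ /=.
  by apply: eq_bigr => j _; rewrite centre_leaf.
by rewrite big1 ?addn0 // => j _; rewrite centre_leaf.
Qed.

Lemma card_zero_divisor_graph : #|zero_divisor_graph (2 * p)| = p.
Proof.
rewrite -sum1_card (sum_residue (fun=> 1)) sum_nat_const_nat muln1.
by have := prime_gt0 p_pr; lia.
Qed.

End Star.

(** * The labelling and its weights, as arithmetic on residues *)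

Lemma sum_arith (a b k : nat) :
  2 * \sum_(1 <= j < k.+1) (a + b * j) = 2 * a * k + b * (k * k.+1).
Proof.
elim: k => [|k IHk]; first by rewrite big_geq //; lia.
by rewrite big_nat_recr //= mulnDr IHk; nia.
Qed.

Definition label (m s t : nat) : nat :=
  if s == 3 then (if t == m then 3 * m else t./2)
  else if s == 2 then (if t == m then m else m - 1 + t)
  else (if t == m then 3 * m - 1 else m + t).

Section Label.

Variable m : nat.
Hypotheses (m_odd : odd m) (m_gt1 : 1 < m).

Lemma leaf_neq_centre (j : nat) : (2 * j == m) = false.
Proof. by apply/eqP; lia. Qed.

Lemma label_centre (s : nat) :
  label m s m = if s == 3 then 3 * m else if s == 2 then m else 3 * m - 1.
Proof. by rewrite /label eqxx. Qed.

Lemma label_leaf (s j : nat) :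
  label m s (2 * j) =
  if s == 3 then j else if s == 2 then m - 1 + 2 * j else m + 2 * j.
Proof. by rewrite /label leaf_neq_centre mul2n doubleK. Qed.

Lemma label_bound (s t : nat) :
  t = m \/ (exists2 j, 0 < j < m & t = 2 * j) -> 0 < label m s t <= 3 * m.
Proof.
case=> [->|[j j_lt ->]]; rewrite ?label_centre ?label_leaf; last first.
  by case: eqP => _; [|case: eqP => _]; lia.
by case: eqP => _; [|case: eqP => _]; lia.
Qed.

(** The leaves of row 3 take 1, ..., m - 1. Those of rows 2 and 4 interleave through m + 1, ..., 3m
    - 2, with even labels in row 2 and odd ones in row 4 since m is odd. This leaves m, 3m - 1 and
    3m for the centre. *)
Lemma label_inj (s s' t t' : nat) :
  s = 2 \/ s = 3 \/ s = 4 -> s' = 2 \/ s' = 3 \/ s' = 4 ->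
  t = m \/ (exists2 j, 0 < j < m & t = 2 * j) ->
  t' = m \/ (exists2 j, 0 < j < m & t' = 2 * j) ->
  label m s t = label m s' t' -> s = s' /\ t = t'.
Proof.
move=> [->|[->|->]] [->|[->|->]] [->|[j j_lt ->]] [->|[j' j'_lt ->]].
all: by rewrite ?label_centre ?label_leaf /=; lia.
Qed.

Lemma sum_label_leaf (s : nat) :
  2 * \sum_(1 <= j < m) label m s (2 * j) =
  (m - 1) * (if s == 3 then m else if s == 2 then 4 * m - 2 else 4 * m).
Proof.
have sum_leaves a b : (forall j, label m s (2 * j) = a + b * j) ->
    2 * \sum_(1 <= j < m) label m s (2 * j) = (m - 1) * (2 * a + b * m).
  move=> labelE; under eq_bigr do rewrite labelE.
  by case: m m_odd => // k _; rewrite sum_arith subn1 /=; nia.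
have := label_leaf s; case: eqP => _; [|case: eqP => _] => labelE.
- by rewrite (sum_leaves 0 1) => [|j]; rewrite ?labelE; nia.
- by rewrite (sum_leaves (m - 1) 2) //; nia.
- by rewrite (sum_leaves m 2) //; nia.
Qed.

(** The first summand runs over the neighbours along the path 2 - 3 - 4, the second over those along
    the star. *)
Definition label_weight (s t : nat) : nat :=
  (if s == 3 then label m 2 t + label m 4 t else label m 3 t) +
  (if t == m then \sum_(1 <= j < m) label m s (2 * j) else label m s m).

Lemma label_weight_inj (s s' t t' : nat) :
  s = 2 \/ s = 3 \/ s = 4 -> s' = 2 \/ s' = 3 \/ s' = 4 ->
  t = m \/ (exists2 j, 0 < j < m & t = 2 * j) ->
  t' = m \/ (exists2 j, 0 < j < m & t' = 2 * j) ->
  label_weight s t = label_weight s' t' -> s = s' /\ t = t'.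
Proof.
have square_ge : 3 * m <= m * m by rewrite leq_mul2r; lia.
have [q squareE] : exists q, m * m = 4 * q + 1 by exists (m./2 * m./2 + m./2); nia.
(* The ranges are m + 1 to 2m - 1 in row 2, 3m to 4m - 2 in row 4, and 5m + 3 to 9m - 5 in row 3. *)
have leaf_weight j u : 0 < j < m -> label_weight u (2 * j) =
    if u == 3 then 5 * m + 4 * j - 1
    else if u == 2 then m + j else 3 * m - 1 + j.
  move=> j_lt; rewrite /label_weight leaf_neq_centre !label_leaf label_centre.
  by case: eqP => _ /=; [|case: eqP => _]; lia.
(* Doubling clears the halves of the arithmetic sums. *)
have centre_weight u : 2 * label_weight u m =
    if u == 3 then m * m + 7 * m - 2
    else if u == 2 then 4 * (m * m) + 2 else 4 * (m * m) + 2 * m.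
  rewrite /label_weight eqxx mulnDr sum_label_leaf !label_centre.
  by case: eqP => _ /=; [|case: eqP => _]; nia.
(* A collision forces m(m - 3) = 8j < 8m, hence m < 11; for m = 3, 5, 7, 9 the left side is 0, 10,
   28, 54, never a positive multiple of 8. *)
have small_centre j : 0 < j < m -> m * m + 7 * m - 2 <> 2 * (5 * m + 4 * j - 1).
  have [m_ge11|m_lt11] := leqP 11 m; first by nia.
  have : m \in [:: 1; 3; 5; 7; 9] by rewrite !inE; lia.
  by rewrite !inE => /or4P[/eqP->|/eqP->|/eqP->|/orP[]/eqP->]; lia.
move=> [->|[->|->]] [->|[->|->]] [->|[j j_lt ->]] [->|[j' j'_lt ->]].
(* Against the leaves of row 3, whose weights are even, the centre has odd weight in rows 2 and 4,
   and [small_centre] handles row 3. *)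
all: move=> /(congr1 (muln 2)); rewrite ?centre_weight ?leaf_weight //=; try lia.
all: try by move: (small_centre _ j_lt); lia.
all: try by move: (small_centre _ j'_lt); lia.
Qed.

End Label.

Theorem theorem2p10 (m : nat) (pr_m : prime m) (m_neq2 : m <> 2) :
  admits_DAML (cart_prod (zero_divisor_graph 6) (zero_divisor_graph (2 * m))).
Proof.
have m_odd : odd m by case: (even_prime pr_m) => // /m_neq2.
have m_gt1 := prime_gt1 pr_m.
pose G := cart_prod (zero_divisor_graph 6) (zero_divisor_graph (2 * m)).
pose f (q : G) := label m (residue q.1) (residue q.2).
have rowP (x : zero_divisor_graph 6) :
    residue x = 2 \/ residue x = 3 \/ residue x = 4.
  (* The first factor is the star for [p = 3], as [6] and [2 * 3] are convertible. *)
  have : residue x = 3 \/ exists2 j, 0 < j < 3 & residue x = 2 * j.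
    exact: (@residueP 3).
  by case=> [|[j]]; lia.
have colP := residueP m pr_m m_odd.
have vertex_eq (q q' : G) :
    residue q.1 = residue q'.1 /\ residue q.2 = residue q'.2 -> q = q'.
  by case: q q' => [x y] [x' y'] /= [/residue_inj-> /residue_inj->].
have f_inj : injective f.
  by move=> q q' /(label_inj _ m_odd m_gt1) fE; apply/vertex_eq/fE.
have card_G : #|G| = 3 * m.
  rewrite card_prod (card_zero_divisor_graph m pr_m m_odd).
  by congr (_ * _); apply: (@card_zero_divisor_graph 3).
have f_bound q : 0 < f q <= 3 * m by apply: label_bound.
exists f; split=> //.
  rewrite card_G => k; split=> [[q <-] //|k_bound].
  (* Labels are positive, so lowering them by one keeps them distinct; an injection into
     ['I_(3 * m)] from a set of the same size is onto. *)
  have g_lt q : (f q).-1 < 3 * m by have := f_bound q; lia.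
  pose g q := Ordinal (g_lt q).
  have g_inj : injective g.
    move=> q q' [] e; apply: f_inj.
    by have := f_bound q; have := f_bound q'; lia.
  have k_lt : k.-1 < 3 * m by lia.
  have /codomP[q [kE]] : Ordinal k_lt \in codom g.
    by apply: inj_card_onto; rewrite // card_ord card_G.
  by exists q; have := f_bound q; lia.
have weightE q : weight f q = label_weight m (residue q.1) (residue q.2).
  case: q => x y; rewrite weight_cart /label_weight /=; congr (_ + _).
    (* Unlocking evaluates the sum over [1 <= j < 3] to the rows 2 and 4. *)
    have := @sum_edge_residue 3 isT isT (fun s => label m s (residue y)) x.
    by rewrite unlock /= addn0.
  exact: (sum_edge_residue m pr_m m_odd (fun t => label m (residue x) t)).
move=> q q'; rewrite !weightE => /(label_weight_inj _ m_odd m_gt1) wE.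
exact/vertex_eq/wE.
Qed.
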